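(* Let $\mathbb{K}$ be an algebraically closed field of characteristic zero, let $b\in\mathbb{K}^*$, and let $D=\dfrac{\partial}{\partial X}+bY\dfrac{\partial}{\partial Y}$, a derivation of $\mathbb{K}[X,Y]$. Then \[ \operatorname{Aut}_D(\mathbb{K}[X,Y])=\{(X+\beta,\ \gamma Y)\mid \beta\in\mathbb{K},\ \gamma\in\mathbb{K}^*\}. \]
   Context: For a derivation $D$ of $\mathbb{K}[X,Y]$, $\operatorname{Aut}_D(\mathbb{K}[X,Y])$ denotes the isotropy group of $D$: the group of all $\mathbb{K}$-algebra automorphisms $\rho$ of $\mathbb{K}[X,Y]$ with $\rho D=D\rho$. A pair $(F,G)$ of polynomials denotes the $\mathbb{K}$-algebra endomorphism $\rho$ of $\mathbb{K}[X,Y]$ with $\rho(X)=F$ and $\rho(Y)=G$. *)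

(* Defs.v *)
From mathcomp Require Import all_boot all_algebra.
From mathcomp Require Import mpoly.

Set Implicit Arguments.
Unset Strict Implicit.
Unset Printing Implicit Defensive.

Import GRing.Theory.
Local Open Scope ring_scope.

(* K[X, Y] is {mpoly K[2]}; X and Y are the indeterminates of index 0 and 1. *)
Definition Xvar (K : fieldType) : {mpoly K[2]} := 'X_(0 : 'I_2).
Definition Yvar (K : fieldType) : {mpoly K[2]} := 'X_(1 : 'I_2).
Arguments Xvar {K}.
Arguments Yvar {K}.

Definition is_derivation (K : fieldType) (D : {mpoly K[2]} -> {mpoly K[2]}) : Prop :=
  linear D /\ forall p q, D (p * q) = D p * q + p * D q.

Definition is_alg_automorphism (K : fieldType)
    (rho : {mpoly K[2]} -> {mpoly K[2]}) : Prop :=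
  [/\ linear rho, monoid_morphism rho & bijective rho].

(* Membership of rho in Aut_D(K[X, Y]). *)
Definition in_isotropy (K : fieldType) (D rho : {mpoly K[2]} -> {mpoly K[2]}) : Prop :=
  is_alg_automorphism rho /\ rho \o D =1 D \o rho.

(* The endomorphism (F, G): substitution of F for X and of G for Y. *)
Definition endo (K : fieldType) (F G : {mpoly K[2]}) (p : {mpoly K[2]}) :
    {mpoly K[2]} :=
  p \mPo [tuple F; G].

Definition derD (K : fieldType) (b : K) (p : {mpoly K[2]}) : {mpoly K[2]} :=
  p^`M(0) + b *: (Yvar * p^`M(1)).

Lemma derD_derivation (K : fieldType) (b : K) : is_derivation (derD b).
Proof.
split=> [a p q|p q]; rewrite /derD.
  rewrite !mderivD !mderivZ mulrDr -scalerAr !scalerDr !scalerA (mulrC b).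
  by rewrite addrACA.
rewrite !mderivM !mulrDr scalerDr mulrDl -scalerAl -scalerAr addrACA.
by rewrite (mulrCA p) (mulrA Yvar p^`M(1)).
Qed.

Lemma endo_alg (K : fieldType) (F G : {mpoly K[2]}) :
  [/\ linear (endo F G), monoid_morphism (endo F G),
      endo F G Xvar = F & endo F G Yvar = G].
Proof.
split.
- by move=> a p q; rewrite /endo comp_mpolyD comp_mpolyZ.
- by split=> [|p q]; rewrite /endo ?rmorph1 ?rmorphM.
- by rewrite /endo comp_mpolyXU.
- by rewrite /endo comp_mpolyXU.
Qed.

(* Main.v *)
(** Comparing coefficients of X^i Y^j in D p = k b p gives
    (i + 1) p_(i+1,j) = b (k - j) p_(i,j).  For j != k the coefficient p_(i,j)
    is thus a multiple of p_(i+1,j), hence zero because p has finite degree;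
    for j = k only i = 0 survives.  So the k b-eigenspace of D is K Y^k.  If rho
    commutes with D then D (rho X - X) = 0 and D (rho Y) = b rho Y, so that
    rho X - X is constant and rho Y is a multiple of Y. *)

Require Import Defs.
From mathcomp Require Import all_boot all_algebra.
From mathcomp Require Import mpoly.

Import GRing.Theory.
Local Open Scope ring_scope.

(** Every monomial is a product of variables, so closure under sums and products reaches all
    polynomials. This reduces identities between maps of algebras to the generators. *)
Lemma mpoly_alg_ind (n : nat) (R : nzRingType) (P : {mpoly R[n]} -> Prop) :
  (forall c, P c%:MP) -> (forall i, P 'X_i) ->
  (forall p q, P p -> P q -> P (p + q)) ->
  (forall p q, P p -> P q -> P (p * q)) ->
  forall p, P p.
Proof.
move=> PC PX PD PM; have P1 : P 1 by rewrite -mpolyC1.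
elim/mpolyind => [|c m p _ _ Pp]; first by rewrite -mpolyC0.
apply: (PD _ _ _ Pp); rewrite -mul_mpolyC; apply: (PM _ _ (PC c)).
rewrite mpolyXE_id; apply: (big_ind P P1 PM) => i _.
by elim: (m i) => [|k IHk]; rewrite ?expr0 // exprS; apply: PM.
Qed.

Lemma mcoeff_mulX_mderiv (n : nat) (R : comNzRingType) (i : 'I_n)
    (p : {mpoly R[n]}) (m : 'X_{1..n}) :
  ('X_i * p^`M(i))@_m = p@_m *+ m i.
Proof.
elim/mpolyind: p => [|c k p _ _ IHp]; first by rewrite mderiv0 mulr0 mcoeff0 mul0rn.
rewrite mderivD mderivZ mderivX mulrDr -!scalerAr !mcoeffD IHp mulrnDl !mcoeffZ.
(* Exponent 0 is treated apart: there the truncated [k - U_(i)] is not undone by multiplying by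
   ['X_i], but the factor [k i] vanishes. *)
congr (_ + _); have [k0|k_gt0] := posnP (k i).
  by rewrite k0 mul0r mulr0 mcoeffX; case: eqP => [<-|]; rewrite ?k0 ?mulr0 ?mul0rn.
rewrite -mpolyXD addmC submK; last first.
  by apply/mnm_lepP => j; rewrite mnm1E; case: eqP => // <-.
rewrite mcoeffX; case: eqP => [->|_]; last by rewrite !mulr0 mul0rn.
by rewrite !mulr1 mulr_natr.
Qed.

Lemma mderivXU (n : nat) (R : nzRingType) (i j : 'I_n) :
  ('X_i : {mpoly R[n]})^`M(j) = (i == j)%:R.
Proof.
rewrite mderivX mnm1E; case: eqP => [->|_]; last by rewrite scale0r.
by rewrite scale1r -{1}[U_(j)%MM]add0m addmK mpolyX0.
Qed.

Lemma ord2_ind (P : 'I_2 -> Prop) : P 0 -> P 1 -> forall i, P i.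
Proof.
move=> P0 P1 [[|[|//]] lt_i]; first by rewrite (_ : Ordinal _ = 0) //; apply: val_inj.
by rewrite (_ : Ordinal _ = 1) //; apply: val_inj.
Qed.

Section PlaneEndomorphisms.
Variable K : fieldType.
Implicit Types (b c : K) (p q : {mpoly K[2]}).
Implicit Types rho sigma delta : {mpoly K[2]} -> {mpoly K[2]}.

Lemma linear_morphD delta : linear delta -> {morph delta : p q / p + q}.
Proof. by move=> lin p q; rewrite -[p]scale1r lin !scale1r. Qed.

Lemma alg_endo_const rho c :
  linear rho -> monoid_morphism rho -> rho c%:MP = c%:MP.
Proof.
by move=> lin [rho1 _]; rewrite -alg_mpolyC (scalable_linear lin) rho1.
Qed.

Lemma derivation_const delta c : is_derivation delta -> delta c%:MP = 0.
Proof.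
move=> [lin leib]; rewrite -alg_mpolyC (scalable_linear lin).
suff -> : delta 1 = 0 by rewrite /= scaler0.
by have /eqP := leib 1 1; rewrite !mulr1 mul1r -subr_eq0 opprD addNKr oppr_eq0 => /eqP.
Qed.

Lemma eq_alg_endo rho sigma :
  linear rho -> monoid_morphism rho -> linear sigma -> monoid_morphism sigma ->
  rho Xvar = sigma Xvar -> rho Yvar = sigma Yvar -> rho =1 sigma.
Proof.
move=> rhoL rhoM sigmaL sigmaM eqX eqY; apply: mpoly_alg_ind => [c||p q|p q].
- by rewrite !alg_endo_const.
- exact: ord2_ind.
- by rewrite !linear_morphD // => -> ->.
- by rewrite rhoM.2 sigmaM.2 => -> ->.
Qed.

(** Both composites obey the same twisted Leibniz rule, d(pq) = d(p) rho(q) + rho(p) d(q), so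
    agreement on X and Y propagates to products. *)
Lemma alg_endo_derivation_comm rho delta :
  linear rho -> monoid_morphism rho -> is_derivation delta ->
  rho (delta Xvar) = delta (rho Xvar) -> rho (delta Yvar) = delta (rho Yvar) ->
  rho \o delta =1 delta \o rho.
Proof.
move=> rhoL rhoM deltaD eqX eqY; have [deltaL leib] := deltaD.
apply: mpoly_alg_ind => [c||p q|p q] /=.
- rewrite (alg_endo_const _ _ rhoL rhoM) !(derivation_const _ _ deltaD).
  by rewrite -mpolyC0 (alg_endo_const _ _ rhoL rhoM).
- exact: ord2_ind.
- by rewrite !linear_morphD // => -> ->.
- by rewrite rhoM.2 !leib linear_morphD // !rhoM.2 => -> ->.
Qed.

Lemma derD_X b : derD b Xvar = 1.
Proof.
by rewrite /derD !mderivXU mulr0 scaler0 addr0.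
Qed.

Lemma derD_Y b : derD b Yvar = b *: Yvar.
Proof.
by rewrite /derD !mderivXU mulr1 add0r.
Qed.

Lemma mcoeff_derD b p (m : 'X_{1..2}) :
  (derD b p)@_m = p@_(m + U_(0)) *+ (m 0%R).+1 + b * (p@_m *+ m 1%R).
Proof. by rewrite mcoeffD mcoeffZ mcoeff_mderiv mcoeff_mulX_mderiv. Qed.

Lemma derD_eigenvector b k p :
  [pchar K] =i pred0 -> b != 0 -> derD b p = (b *+ k) *: p ->
  p = p@_(U_(1) *+ k) *: Yvar ^+ k.
Proof.
move=> charK b_neq0 Dp; have natr_eq0 := (pcharf0P K).1 charK.
have rec (m : 'X_{1..2}) :
    p@_(m + U_(0)) *+ (m 0%R).+1 = b * (k%:R - (m 1%R)%:R) * p@_m.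
  have := congr1 (mcoeff m) Dp; rewrite mcoeff_derD mcoeffZ.
  move/(canRL (addrK _)) ->.
  by rewrite mulrBr mulrBl mulr_natr -mulrA mulr_natl.
(* Descending induction on the degree of m. *)
have off_diag n : forall m : 'X_{1..2},
    (msize p <= mdeg m + n)%N -> m 1%R != k -> p@_m = 0.
  elim: n => [|n IHn] m le_p m1.
    (* [msize p] exceeds the degree of every monomial of [p], so [m] lies outside the support. *)
    by apply/memN_msupp_eq0/msize_mdeg_ge; rewrite -(addn0 (mdeg m)).
  have := rec m; rewrite IHn ?mul0rn; last 2 first.
  - by rewrite mdegD mdeg1 -addnA add1n.
  - by rewrite mnmDE mnm1E addn0.
  move/esym/eqP; rewrite !mulf_eq0 (negPf b_neq0) /= => /orP[|/eqP//].
  (* The factor k - j is nonzero in characteristic zero. Its sign is split off so that it becomes,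
     up to sign, the image of a positive natural number. *)
  have [lt_m1|lt_k|eq_m1] := ltngtP (m 1%R) k; last by rewrite eq_m1 eqxx in m1.
  - by rewrite -(natrB _ (ltnW lt_m1)) natr_eq0 subn_eq0 leqNgt lt_m1.
  - by rewrite -oppr_eq0 opprB -(natrB _ (ltnW lt_k)) natr_eq0 subn_eq0 leqNgt lt_k.
apply/mpolyP => m; rewrite mcoeffZ mcoeffXn.
case: eqP => [->|ne_m]; first by rewrite mulr1.
rewrite mulr0; have [m1|] := eqVneq (m 1%R) k; last first.
  by apply: (off_diag (msize p)); rewrite leq_addl.
have m0 : m 0%R != 0%N.
  apply/eqP => m0; apply: ne_m; apply/mnmP; apply: ord2_ind.
  - by rewrite mulmnE mnm1E m0.
  - by rewrite mulmnE mnm1E m1 mul1n.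
have le_m : (U_(0%R) <= m)%MM.
  by apply/mnm_lepP => j; rewrite mnm1E; case: eqP => // <-; rewrite lt0n.
(* One step down in X the right-hand side of the recursion carries the factor k - k = 0, so a
   positive multiple of [p@_m] vanishes. *)
have := rec (m - U_(0%R))%MM; rewrite submK // !mnmBE !mnm1E m1 subn0 subrr.
by rewrite mulr0 mul0r -mulr_natr => /eqP; rewrite mulf_eq0 natr_eq0 orbF => /eqP.
Qed.

(** The composite is an algebra endomorphism fixing X and Y. The hypotheses are symmetric in the two
    maps, so exchanging them gives the other cancellation as well. *)
Lemma endo_shift_scaleK beta beta' c c' :
  beta + beta' = 0 -> c * c' = 1 ->
  cancel (endo (Xvar + beta%:MP) (c *: Yvar)) (endo (Xvar + beta'%:MP) (c' *: Yvar)).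
Proof.
move=> beta0 c1 p.
have [fL fM fX fY] := endo_alg (Xvar + beta%:MP) (c *: Yvar).
have [gL gM gX gY] := endo_alg (Xvar + beta'%:MP) (c' *: Yvar).
set f := endo _ _ in fL fM fX fY *; set g := endo _ _ in gL gM gX gY *.
suff: g \o f =1 id by move/(_ p).
apply: eq_alg_endo => //= [a q r|||].
- by rewrite /= fL gL.
- by split=> [|q r] /=; rewrite ?fM.1 ?gM.1 // fM.2 gM.2.
- rewrite fX (linear_morphD _ gL) gX (alg_endo_const _ _ gL gM) -addrA -mpolyCD.
  by rewrite [beta' + _]addrC beta0 mpolyC0 addr0.
- by rewrite fY (scalable_linear gL) /= gY scalerA c1 scale1r.
Qed.

End PlaneEndomorphisms.

Theorem theorem3p4 (K : closedFieldType) (charK : [pchar K] =i pred0)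
    (b : K) (b_neq0 : b != 0) (rho : {mpoly K[2]} -> {mpoly K[2]}) :
  in_isotropy (derD b) rho <->
  exists beta gamma : K,
    gamma != 0 /\ rho =1 endo (Xvar + beta%:MP) (gamma *: Yvar).
Proof.
have DD := derD_derivation b; have [DL _] := DD.
split=> [[[rhoL rhoM rho_bij] comm]|[beta [gamma [gamma_neq0 rhoE]]]].
  have DX : derD b (rho Xvar - Xvar) = (b *+ 0) *: (rho Xvar - Xvar).
    rewrite (zmod_morphism_linear DL) -[derD b (rho _)]comm /= derD_X rhoM.1.
    by rewrite subrr mulr0n scale0r.
  have DY : derD b (rho Yvar) = (b *+ 1) *: rho Yvar.
    by rewrite -[derD b (rho _)]comm /= derD_Y (scalable_linear rhoL).
  have /(canRL (subrK _)) rhoX := derD_eigenvector K b _ _ charK b_neq0 DX.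
  have rhoY := derD_eigenvector K b _ _ charK b_neq0 DY.
  rewrite expr0 alg_mpolyC addrC in rhoX; rewrite expr1 in rhoY.
  (* [beta] is the constant coefficient of rho X - X, and [gamma] is the coefficient of Y in rho
     Y. *)
  move: (_@__) rhoX => beta rhoX; move: (_@__) rhoY => gamma rhoY.
  exists beta, gamma; split.
    (* If [gamma] were 0, then rho Y = 0 = rho 0, and injectivity would force Y = 0. *)
    apply/eqP => gamma0; move: rhoY; rewrite gamma0 scale0r => rhoY.
    have /(bij_inj rho_bij)/(congr1 (mcoeff U_(1%R)%MM)) : rho Yvar = rho 0.
      by rewrite rhoY -mpolyC0 alg_endo_const.
    by rewrite mcoeffXU mcoeff0 => /eqP; rewrite oner_eq0.
  have [eL eM eX eY] := endo_alg (Xvar + beta%:MP) (gamma *: Yvar).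
  by apply: eq_alg_endo => //; rewrite ?eX ?eY.
have [eL eM eX eY] := endo_alg (Xvar + beta%:MP) (gamma *: Yvar).
have rhoL : linear rho by move=> a p q; rewrite !rhoE eL.
have rhoM : monoid_morphism rho by split=> [|p q]; rewrite !rhoE ?eM.1 ?eM.2.
split; first split=> //.
  apply: (eq_bij _ (fun p => esym (rhoE p))).
  exists (endo (Xvar + (- beta)%:MP) (gamma^-1 *: Yvar)); apply: endo_shift_scaleK;
    by rewrite ?subrr ?addNr ?mulfV ?mulVf.
(* On the generators, both composites send X to 1 and Y to b gamma Y. *)
apply: alg_endo_derivation_comm => //; rewrite ?derD_X ?derD_Y.
  by rewrite rhoM.1 rhoE eX linear_morphD // derD_X derivation_const // addr0.
by rewrite (scalable_linear rhoL) rhoE eY (scalable_linear DL) /= derD_Y !scalerA mulrC.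
Qed.
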